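(* Let $A$ be a quasi-triangular bialgebra with universal $r$-matrix $R\in A\otimes A$, and let $V$ be a module over $A$. Then $\tau_{R,V,V}=\tau_{V,V}\circ R\in\mathrm{Aut}_A(V\otimes V)$ is a solution of the Yang-Baxter equation, i.e. $$(\tau_{R,V,V}\otimes\mathrm{id})\circ(\mathrm{id}\otimes\tau_{R,V,V})\circ(\tau_{R,V,V}\otimes\mathrm{id})=(\mathrm{id}\otimes\tau_{R,V,V})\circ(\tau_{R,V,V}\otimes\mathrm{id})\circ(\mathrm{id}\otimes\tau_{R,V,V})$$ in $\mathrm{End}(V^{\otimes3})$. In particular, for every $n\ge2$ the vector space $V^{\otimes n}$ is a representation of the braid group $B_n$, with $\sigma_i$ acting by $\mathrm{id}^{\otimes(i-1)}\otimes\tau_{R,V,V}\otimes\mathrm{id}^{\otimes(n-i-1)}$.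
   Context: A bialgebra $(A,\mu,\eta,\Delta,\epsilon)$ is a complex vector space $A$ with a unital associative algebra structure $(\mu,\eta)$ and a counital coassociative coalgebra structure $(\Delta,\epsilon)$ such that $\Delta:A\to A\otimes A$ is a morphism of associative algebras. For $A$-modules $V,W$, $V\otimes W$ is an $A$-module via $a(v\otimes w)=\Delta(a)(v\otimes w)$. An almost-cocommutative bialgebra is a bialgebra together with an invertible element $R\in A\otimes A$ (the universal $r$-matrix) such that $\tau_{A,A}(\Delta(a))=R\,\Delta(a)\,R^{-1}$ for all $a\in A$, where $\tau_{A,A}(a\otimes b)=b\otimes a$. A quasi-triangular bialgebra is an almost-cocommutative bialgebra whose universal $r$-matrix satisfies $(\Delta\otimes\mathrm{id})R=R_{13}R_{23}$ and $(\mathrm{id}\otimes\Delta)R=R_{13}R_{12}$, where $R_{12}=R\otimes1$, $R_{23}=1\otimes R$ and $R_{13}=(\tau_{A,A}\otimes\mathrm{id})(R_{23})$. $\tau_{V,V}(v\otimes w)=w\otimes v$, and $R$ acts on $V\otimes V$ through the $A\otimes A$-module structure. The braid group $B_n$ is generated by $\sigma_1,\dots,\sigma_{n-1}$ modulo $\sigma_i\sigma_{i+1}\sigma_i=\sigma_{i+1}\sigma_i\sigma_{i+1}$ for $1\le i\le n-2$ and $\sigma_i\sigma_j=\sigma_j\sigma_i$ for $|i-j|\ge2$. *)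

(* Defs.v *)
From HB Require Import structures.
From mathcomp Require Import all_boot all_order all_algebra.
From mathcomp Require Import boolp classical_sets.

Set Implicit Arguments.
Unset Strict Implicit.
Unset Printing Implicit Defensive.

Import GRing.Theory.
Local Open Scope ring_scope.
Local Open Scope quotient_scope.

(* V \OT W is the quotient of the formal sums of pairs, encoded as finite     *)
(* sequences of pairs, by the congruence generated by bilinearity.            *)

Section TensorRel.
Variables (K : comNzRingType) (V W : lmodType K).

Inductive tensor_rel : seq (V * W) -> seq (V * W) -> Prop :=
| TensorRefl s : tensor_rel s s
| TensorSym s t : tensor_rel s t -> tensor_rel t s
| TensorTrans t s u : tensor_rel s t -> tensor_rel t u -> tensor_rel s u
| TensorCat s s' t t' :
    tensor_rel s s' -> tensor_rel t t' -> tensor_rel (s ++ t) (s' ++ t')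
| TensorCatC s t : tensor_rel (s ++ t) (t ++ s)
| Tensor0 w : tensor_rel [:: (0, w)] [::]
| TensorDl v v' w : tensor_rel [:: (v + v', w)] [:: (v, w); (v', w)]
| TensorDr v w w' : tensor_rel [:: (v, w + w')] [:: (v, w); (v, w')]
| TensorZ k v w : tensor_rel [:: (k *: v, w)] [:: (v, k *: w)].

Definition tensor_relb : rel (seq (V * W)) := fun s t => `[< tensor_rel s t >].

Lemma tensor_relb_equiv : equiv_class_of tensor_relb.
Proof.
split=> [s|s t|t s u].
- by apply/asboolP; constructor.
- by apply/asboolP/asboolP => /TensorSym.
- by move=> /asboolP st /asboolP tu; apply/asboolP; apply: TensorTrans tu.
Qed.

Canonical tensor_equiv := EquivRelPack tensor_relb_equiv.

Definition tensor := {eq_quot tensor_equiv}.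
HB.instance Definition _ := EqQuotient.on tensor.
HB.instance Definition _ := Choice.on tensor.

Lemma tensor_piP s t : tensor_rel s t <-> \pi_tensor s = \pi_tensor t.
Proof. by split=> [st|/eqmodP/asboolP//]; apply/eqmodP/asboolP. Qed.

Lemma tensor_repr s : tensor_rel (repr (\pi_tensor s)) s.
Proof. by apply/tensor_piP; rewrite reprK. Qed.

Definition tensor_zero : tensor := \pi_tensor [::].
Definition tensor_add (x y : tensor) : tensor := \pi_tensor (repr x ++ repr y).
Definition tensor_scale (k : K) (x : tensor) : tensor :=
  \pi_tensor [seq (k *: p.1, p.2) | p <- repr x].
Definition tensor_opp : tensor -> tensor := tensor_scale (- 1).

Lemma pi_add s t :
  tensor_add (\pi_tensor s) (\pi_tensor t) = \pi_tensor (s ++ t).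
Proof. by apply/tensor_piP/TensorCat; apply: tensor_repr. Qed.

Lemma tensor_rel_scale k s t : tensor_rel s t ->
  tensor_rel [seq (k *: p.1, p.2) | p <- s] [seq (k *: p.1, p.2) | p <- t].
Proof.
elim=> {s t} [s|s t _ /TensorSym//|t s u _ IHst _ IHtu|s s' t t' _ IHs _ IHt|s t|w
            |v v' w|v w w'|l v w] /=.
- exact: TensorRefl.
- exact: TensorTrans IHst IHtu.
- by rewrite !map_cat; apply: TensorCat.
- by rewrite !map_cat; apply: TensorCatC.
- by rewrite scaler0; apply: Tensor0.
- by rewrite scalerDr; apply: TensorDl.
- exact: TensorDr.
- by rewrite scalerA mulrC -scalerA; apply: TensorZ.
Qed.

Lemma pi_scale k s :
  tensor_scale k (\pi_tensor s) = \pi_tensor [seq (k *: p.1, p.2) | p <- s].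
Proof. exact/tensor_piP/tensor_rel_scale/tensor_repr. Qed.

Lemma tensor_addA : associative tensor_add.
Proof.
elim/quotW=> s; elim/quotW=> t; elim/quotW=> u.
by rewrite (pi_add t u) (pi_add s t) !pi_add catA.
Qed.

Lemma tensor_addC : commutative tensor_add.
Proof.
elim/quotW=> s; elim/quotW=> t; rewrite !pi_add.
exact/tensor_piP/TensorCatC.
Qed.

Lemma tensor_add0 : left_id tensor_zero tensor_add.
Proof. by elim/quotW=> s; rewrite pi_add. Qed.

Lemma tensor_scaleDl x :
  {morph tensor_scale^~ x : k l / k + l >-> tensor_add k l}.
Proof.
elim/quotW: x => s k l; rewrite !pi_scale pi_add; apply/tensor_piP.
elim: s => [|p s IHs] /=; first exact: TensorRefl.
rewrite scalerDl -cat1s.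
apply: (@TensorTrans ([:: (k *: p.1, p.2); (l *: p.1, p.2)] ++
  ([seq (k *: q.1, q.2) | q <- s] ++ [seq (l *: q.1, q.2) | q <- s]))).
  by apply: TensorCat IHs; apply: TensorDl.
apply: (@TensorCat [:: _] [:: _] (_ :: _)); first exact: TensorRefl.
rewrite -[in X in tensor_rel X _]cat1s -[X in tensor_rel _ (_ ++ X)]cat1s !catA.
by apply: TensorCat (TensorRefl _); apply: TensorCatC.
Qed.

Lemma tensor_scale0 x : tensor_scale 0 x = tensor_zero.
Proof.
elim/quotW: x => s; rewrite pi_scale; apply/tensor_piP.
elim: s => [|p s IHs] /=; first exact: TensorRefl.
by rewrite -cat1s -[[::]]cats0 scale0r; apply: TensorCat IHs; apply: Tensor0.
Qed.

Lemma tensor_scale1 : left_id 1 tensor_scale.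
Proof.
elim/quotW=> s; rewrite pi_scale; congr \pi_tensor.
by rewrite -[RHS]map_id; apply: eq_map => -[v w] /=; rewrite scale1r.
Qed.

Lemma tensor_addN : left_inverse tensor_zero tensor_opp tensor_add.
Proof.
move=> x; rewrite -[X in tensor_add _ X]tensor_scale1 -tensor_scaleDl addNr.
exact: tensor_scale0.
Qed.

HB.instance Definition _ := GRing.isZmodule.Build tensor
  tensor_addA tensor_addC tensor_add0 tensor_addN.

Lemma tensor_scaleA k l x :
  tensor_scale k (tensor_scale l x) = tensor_scale (k * l) x.
Proof.
elim/quotW: x => s; rewrite (pi_scale l) !pi_scale -map_comp.
congr \pi_tensor.
by apply: eq_map => p /=; rewrite scalerA.
Qed.

Lemma tensor_scaleDr : right_distributive tensor_scale +%R.
Proof.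
move=> k; elim/quotW=> s; elim/quotW=> t.
rewrite [_ + _ in LHS]pi_add (pi_scale k (s ++ t)) map_cat.
by rewrite (pi_scale k s) (pi_scale k t) [RHS]pi_add.
Qed.

HB.instance Definition _ := GRing.Zmodule_isLmodule.Build K tensor
  tensor_scaleA tensor_scale1 tensor_scaleDr tensor_scaleDl.

Definition tens (v : V) (w : W) : tensor := \pi_tensor [:: (v, w)].

Lemma tens_is_bilinear : bilinear_for *:%R *:%R tens.
Proof.
split=> [w|v] k x y /=; rewrite [k *: tens _ _]pi_scale [RHS]pi_add /=;
  apply/tensor_piP; first exact: TensorDl.
apply: TensorTrans (TensorDr _ _ _) _.
rewrite -cat1s -[X in tensor_rel _ X]cat1s.
by apply: TensorCat (TensorRefl _); apply/TensorSym/TensorZ.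
Qed.

HB.instance Definition _ :=
  bilinear_isBilinear.Build K V W tensor *:%R *:%R tens tens_is_bilinear.

Lemma tensor_sum (x : tensor) : x = \sum_(p <- repr x) tens p.1 p.2.
Proof.
rewrite -[LHS]reprK; elim: (repr x) => [|[v w] s IHs]; first by rewrite big_nil.
by rewrite big_cons -IHs [RHS]pi_add.
Qed.

Lemma tensor_ind (P : tensor -> Prop) :
  (forall v w, P (tens v w)) -> (forall x y, P x -> P y -> P (x + y)) ->
  forall x, P x.
Proof.
move=> Ptens PD x; rewrite [x]tensor_sum; elim/big_rec: _ => [|p y _ Py].
  by have <- : tens 0 0 = 0 by [rewrite linear0l]; apply: Ptens.
exact: PD.
Qed.

End TensorRel.

Notation "V \OT W" := (tensor V W) (at level 40, left associativity).
Notation "v \ot w" := (tens v w)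
  (at level 40, left associativity) : ring_scope.

Section TensorLift.
Variables (K : comNzRingType) (V W U : lmodType K).

Definition tlift (f : {bilinear V -> W -> U}) (x : V \OT W) : U :=
  \sum_(p <- repr x) f p.1 p.2.

Variable f : {bilinear V -> W -> U}.

Lemma tlift_rel (s t : seq (V * W)) : tensor_rel s t ->
  \sum_(p <- s) f p.1 p.2 = \sum_(p <- t) f p.1 p.2.
Proof.
elim=> {s t} [s|s t _ ->|t s u _ -> _ ->|s s' t t' _ IHs _ IHt|s t|w
            |v v' w|v w w'|l v w] //=.
- by rewrite !big_cat /= IHs IHt.
- by rewrite !big_cat /= addrC.
- by rewrite big_seq1 big_nil linear0l.
- by rewrite big_seq1 big_cons big_seq1 linearDl.
- by rewrite big_seq1 big_cons big_seq1 linearDr.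
- by rewrite !big_seq1 linearZl_LR linearZr_LR.
Qed.

Lemma tlift_is_linear : linear (tlift f).
Proof.
move=> k; elim/quotW=> s; elim/quotW=> t.
rewrite [k *: _]pi_scale [_ + _ in LHS]pi_add /tlift.
rewrite !(tlift_rel (tensor_repr _)) big_cat /= big_map scaler_sumr.
by congr (_ + _); apply: eq_bigr => p _; rewrite linearZl_LR.
Qed.

HB.instance Definition _ :=
  GRing.isLinear.Build K (V \OT W) U *:%R (tlift f) tlift_is_linear.

Lemma tliftE v w : tlift f (v \ot w) = f v w.
Proof. by rewrite /tlift (tlift_rel (tensor_repr _)) big_seq1. Qed.

Lemma tensor_ext (g h : {linear V \OT W -> U}) :
  (forall v w, g (v \ot w) = h (v \ot w)) -> g =1 h.
Proof.
move=> gh; elim/tensor_ind=> [v w|x y IHx IHy]; first exact: gh.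
by rewrite !linearD IHx IHy.
Qed.

End TensorLift.

Section TensorMaps.
Variables (K : comNzRingType) (U V W V' W' : lmodType K).

Definition flip_bil (v : V) (w : W) : W \OT V := w \ot v.
Lemma flip_is_bilinear : bilinear_for *:%R *:%R flip_bil.
Proof.
by split=> [w|v] k x y; rewrite /flip_bil ?linearPr ?linearPl.
Qed.
HB.instance Definition _ :=
  bilinear_isBilinear.Build K V W (W \OT V) *:%R *:%R flip_bil flip_is_bilinear.
Definition flip : {linear V \OT W -> W \OT V} := tlift flip_bil.
Lemma flipE v w : flip (v \ot w) = w \ot v.
Proof. exact: tliftE. Qed.

Section Map.
Variables (f : {linear V -> V'}) (g : {linear W -> W'}).
Definition tmap_bil (v : V) (w : W) : V' \OT W' := f v \ot g w.
Lemma tmap_is_bilinear : bilinear_for *:%R *:%R tmap_bil.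
Proof.
by split=> [w|v] k x y; rewrite /tmap_bil linearP ?linearPr ?linearPl.
Qed.
HB.instance Definition _ :=
  bilinear_isBilinear.Build K V W (V' \OT W') *:%R *:%R tmap_bil tmap_is_bilinear.
Definition tmap : {linear V \OT W -> V' \OT W'} := tlift tmap_bil.
Lemma tmapE v w : tmap (v \ot w) = f v \ot g w.
Proof. exact: tliftE. Qed.
End Map.

End TensorMaps.

Section TensorAssoc.
Variables (K : comNzRingType) (U V W : lmodType K).

Section Inner.
Variable w : W.
Definition assoc_in (u : U) (v : V) : U \OT (V \OT W) := u \ot (v \ot w).
Lemma assoc_in_is_bilinear : bilinear_for *:%R *:%R assoc_in.
Proof.
split=> [v|u] k x y; rewrite /assoc_in; first by rewrite linearPl.
by rewrite linearPl linearPr.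
Qed.
HB.instance Definition _ := bilinear_isBilinear.Build K U V (U \OT (V \OT W))
  *:%R *:%R assoc_in assoc_in_is_bilinear.
End Inner.

Definition assoc_bil (x : U \OT V) (w : W) := tlift (assoc_in w) x.
Lemma assoc_is_bilinear : bilinear_for *:%R *:%R assoc_bil.
Proof.
split=> [w|x] k y z; rewrite /assoc_bil; first by rewrite linearP.
elim/tensor_ind: x => [u v|x x' IHx IHx'].
  by rewrite !tliftE /= /assoc_in !linearPr.
by rewrite !raddfD /= IHx IHx' scalerDr addrACA.
Qed.
HB.instance Definition _ := bilinear_isBilinear.Build K (U \OT V) W
  (U \OT (V \OT W)) *:%R *:%R assoc_bil assoc_is_bilinear.

Definition tassoc : {linear (U \OT V) \OT W -> U \OT (V \OT W)} :=
  tlift assoc_bil.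

Section InnerInv.
Variable u : U.
Definition assocV_in (v : V) (w : W) : (U \OT V) \OT W := (u \ot v) \ot w.
Lemma assocV_in_is_bilinear : bilinear_for *:%R *:%R assocV_in.
Proof.
split=> [w|v] k x y; rewrite /assocV_in; last by rewrite linearPr.
by rewrite linearPr linearPl.
Qed.
HB.instance Definition _ := bilinear_isBilinear.Build K V W ((U \OT V) \OT W)
  *:%R *:%R assocV_in assocV_in_is_bilinear.
End InnerInv.

Definition assocV_bil (u : U) (x : V \OT W) := tlift (assocV_in u) x.
Lemma assocV_is_bilinear : bilinear_for *:%R *:%R assocV_bil.
Proof.
split=> [x|u] k y z; rewrite /assocV_bil; last by rewrite linearP.
elim/tensor_ind: x => [v w|x x' IHx IHx'].
  by rewrite !tliftE /= /assocV_in !linearPl.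
by rewrite !raddfD /= IHx IHx' scalerDr addrACA.
Qed.
HB.instance Definition _ := bilinear_isBilinear.Build K U (V \OT W)
  ((U \OT V) \OT W) *:%R *:%R assocV_bil assocV_is_bilinear.

Definition tassocV : {linear U \OT (V \OT W) -> (U \OT V) \OT W} :=
  tlift assocV_bil.

Lemma tassocE u v w : tassoc ((u \ot v) \ot w) = u \ot (v \ot w).
Proof. by rewrite /tassoc /= tliftE /= /assoc_bil tliftE. Qed.

Lemma tassocVE u v w : tassocV (u \ot (v \ot w)) = (u \ot v) \ot w.
Proof. by rewrite /tassocV /= tliftE /= /assocV_bil tliftE. Qed.

End TensorAssoc.

(* The identifications K (x) V = V = V (x) K *)
Section TensorUnit.
Variables (K : comNzRingType) (V : lmodType K).

Definition unitl_bil (k : K^o) (v : V) : V := k *: v.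
Lemma unitl_is_bilinear : bilinear_for *:%R *:%R unitl_bil.
Proof.
split=> [v|k] l x y /=; rewrite /unitl_bil.
  by rewrite [l *: (_ *: _)]scalerA -scalerDl.
by rewrite scalerDr !scalerA mulrC.
Qed.
HB.instance Definition _ := bilinear_isBilinear.Build K K^o V V *:%R *:%R
  unitl_bil unitl_is_bilinear.

Definition tunitl : {linear K^o%type \OT V -> V} := tlift unitl_bil.
Lemma tunitlE (k : K^o) v : tunitl (k \ot v) = k *: v.
Proof. exact: tliftE. Qed.
Definition tunitr : {linear V \OT K^o%type -> V} := tunitl \o flip V K^o.

End TensorUnit.

(* F : A x V -> V' and G : B x W -> W' induce (A (x) B) x (V (x) W) ->        *)
(* V' (x) W', (a (x) b, v (x) w) |-> F a v (x) G b w.                         *)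
Section TensorBilinear.
Variables (K : comNzRingType) (A B V W V' W' : lmodType K).
Variables (F : {bilinear A -> V -> V'}) (G : {bilinear B -> W -> W'}).

Section Inner.
Variable z : V \OT W.
Definition tbil_in (a : A) (b : B) : V' \OT W' := tmap (F a) (G b) z.
Lemma tbil_in_is_bilinear : bilinear_for *:%R *:%R tbil_in.
Proof.
rewrite /tbil_in; split=> [b|a] k x y /=;
  (elim/tensor_ind: z => [v w|z1 z2 IH1 IH2];
    last by rewrite !raddfD /= IH1 IH2 addrACA).
- by rewrite !tliftE /= /tmap_bil /= !linearPl.
- by rewrite !tliftE /= /tmap_bil /= linearPl linearPr.
Qed.
HB.instance Definition _ := bilinear_isBilinear.Build K A B (V' \OT W')
  *:%R *:%R tbil_in tbil_in_is_bilinear.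
End Inner.

Definition tbil (x : A \OT B) (z : V \OT W) : V' \OT W' := tlift (tbil_in z) x.
Lemma tbil_is_bilinear : bilinear_for *:%R *:%R tbil.
Proof.
split=> [z|x] k y y'; rewrite /tbil; first by rewrite linearP.
elim/tensor_ind: x => [a b|x x' IHx IHx'].
  by rewrite !tliftE /= /tbil_in linearP.
by rewrite !raddfD /= IHx IHx' scalerDr addrACA.
Qed.
HB.instance Definition _ := bilinear_isBilinear.Build K (A \OT B) (V \OT W)
  (V' \OT W') *:%R *:%R tbil tbil_is_bilinear.

Lemma tbilE a b v w : tbil (a \ot b) (v \ot w) = F a v \ot G b w.
Proof. by rewrite /tbil tliftE /= /tbil_in tmapE. Qed.

End TensorBilinear.

(* An algType is nonzero, so giving A \OT B that structure needs 1 (x) 1 <> 0; *)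
(* this is where the scalars must form a field.                               *)
Section TensorNonzero.
Variable K : fieldType.

Lemma functional_neq0 (V : lmodType K) (v : V) : v != 0 ->
  exists f : {linear V -> K^o}, f v = 1.
Proof.
move=> v0.
pose P (H : set V) := (forall k x y, H x -> H y -> H (k *: x + y)) /\ ~ H v.
have [|H [[HL Hv] Hmax]] := @Zorn_bigcup V P.
  move=> F FP Ftot; split=> [k x y [X FX Xx] [Y FY Yy]|[X FX Xv]]; last first.
    by case: (FP X FX).
  have [XY|YX] := Ftot X Y FX FY.
    by exists Y => //; apply: (FP Y FY).1 => //; apply: XY.
  by exists X => //; apply: (FP X FX).1 => //; apply: YX.
have H0 : H 0.
  apply: contrapT => nH0; apply: (Hmax [set 0]%classic).
    split=> [x Hx|/(_ 0 erefl)//].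
    by case: nH0; rewrite -[0](addNr x) -scaleN1r; apply: HL.
  split=> [k x y -> ->|/= v_0]; first by rewrite scaler0 addr0.
  by rewrite v_0 eqxx in v0.
have HZ k x : H x -> H (k *: x) by move=> Hx; rewrite -[_ *: _]addr0; apply: HL.
have HD x y : H x -> H y -> H (x + y).
  by move=> Hx Hy; rewrite -[x]scale1r; apply: HL.
have ex x : exists c : K, H (x - c *: v).
  have [Hx|nHx] := pselect (H x); first by exists 0; rewrite scale0r subr0.
  pose G := [set z | exists2 h, H h & exists k : K, z = k *: x + h]%classic.
  have [Gv|nGv] := pselect (G v); last first.
    case: (Hmax G) => //; last first.
      split=> // l _ _ [h Hh [k ->]] [h' Hh' [k' ->]].
      exists (l *: h + h'); first exact: HL.
      by exists (l * k + k'); rewrite scalerDr scalerDl scalerA addrACA.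
    split=> [h Hh|/(_ x) GH]; first by exists h => //; exists 0; rewrite scale0r add0r.
    by apply/nHx/GH; exists 0 => //; exists 1; rewrite scale1r addr0.
  case: Gv => h Hh [k vE]; have k0 : k != 0.
    by apply/eqP => k0; apply: Hv; rewrite vE k0 scale0r add0r.
  exists k^-1; rewrite vE scalerDr scalerA mulVf // scale1r opprD addrA subrr.
  by rewrite add0r -scalerN; apply: (HZ); rewrite -scaleN1r; apply: HZ.
have uniq_c x c c' : H (x - c *: v) -> H (x - c' *: v) -> c = c'.
  move=> Hc Hc'; apply/eqP; rewrite -subr_eq0; apply/negPn/negP => cc'; apply: Hv.
  have -> : v = (c - c')^-1 *: ((- 1) *: (x - c *: v) + (x - c' *: v)).
    rewrite scaleN1r opprB addrA subrK -scalerBl scalerA mulVf //.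
    by rewrite scale1r.
  by apply: HZ; apply: HL.
pose f (x : V) : K^o := projT1 (cid (ex x)).
have fP x : H (x - f x *: v) by rewrite /f; case: cid.
have f_lin : linear f.
  move=> k x y; apply: (uniq_c (k *: x + y)); first exact: fP.
  rewrite scalerDl opprD addrACA -scalerA -scalerBr.
  by apply: HL; apply: fP.
pose fL : {linear V -> K^o} := HB.pack f (GRing.isLinear.Build _ _ _ _ f f_lin).
exists fL; apply: (uniq_c v); first exact: fP.
by rewrite scale1r subrr.
Qed.

Lemma tens_neq0 (V W : lmodType K) (v : V) (w : W) :
  v != 0 -> w != 0 -> v \ot w != 0.
Proof.
move=> /functional_neq0[f fv] /functional_neq0[g gw]; apply/eqP => vw0.
have := tunitlE (f v) (g w); rewrite -tmapE vw0 !linear0 fv gw scale1r.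
by apply/eqP; rewrite eq_sym oner_neq0.
Qed.

End TensorNonzero.

Section AlgMul.
Variables (K : comNzRingType) (A : algType K).

Definition algmul (a b : A) : A := a * b.
Lemma algmul_is_bilinear : bilinear_for *:%R *:%R algmul.
Proof.
split=> [b|a] k x y /=; rewrite /algmul; first by rewrite mulrDl scalerAl.
by rewrite mulrDr scalerAr.
Qed.
HB.instance Definition _ :=
  bilinear_isBilinear.Build K A A A *:%R *:%R algmul algmul_is_bilinear.

End AlgMul.

Section TensorAlgebra.
Variables (K : fieldType) (A B : algType K).

Definition tensor_one : A \OT B := 1 \ot 1.
Definition tensor_mul : A \OT B -> A \OT B -> A \OT B :=
  tbil (@algmul K A) (@algmul K B).

Lemma tensor_mulDl : left_distributive tensor_mul +%R.
Proof. by move=> x y z; rewrite /tensor_mul linearDl. Qed.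

Lemma tensor_mulDr : right_distributive tensor_mul +%R.
Proof. by move=> x y z; rewrite /tensor_mul linearDr. Qed.

Lemma tensor_mul_tens (a a' : A) (b b' : B) :
  tensor_mul (a \ot b) (a' \ot b') = (a * a') \ot (b * b').
Proof. by rewrite /tensor_mul tbilE. Qed.

Lemma tensor_mulA : associative tensor_mul.
Proof.
move=> x y z; elim/tensor_ind: x => [a b|x x' IHx IHx']; last first.
  by rewrite !tensor_mulDl IHx IHx'.
elim/tensor_ind: y => [a' b'|y y' IHy IHy']; last first.
  by rewrite tensor_mulDl !tensor_mulDr tensor_mulDl IHy IHy'.
elim/tensor_ind: z => [a'' b''|z z' IHz IHz']; last first.
  by rewrite !tensor_mulDr IHz IHz'.
by rewrite !tensor_mul_tens !mulrA.
Qed.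

Lemma tensor_mul1l : left_id tensor_one tensor_mul.
Proof.
elim/tensor_ind=> [a b|x x' IHx IHx']; last by rewrite tensor_mulDr IHx IHx'.
by rewrite tensor_mul_tens !mul1r.
Qed.

Lemma tensor_mul1r : right_id tensor_one tensor_mul.
Proof.
elim/tensor_ind=> [a b|x x' IHx IHx']; last by rewrite tensor_mulDl IHx IHx'.
by rewrite tensor_mul_tens !mulr1.
Qed.

Lemma tensor_one_neq0 : tensor_one != 0.
Proof. by apply: tens_neq0; apply: oner_neq0. Qed.

HB.instance Definition _ := GRing.Zmodule_isNzRing.Build (A \OT B)
  tensor_mulA tensor_mul1l tensor_mul1r tensor_mulDl tensor_mulDr
  tensor_one_neq0.

Lemma tensor_scalerAl (k : K) (x y : A \OT B) : k *: (x * y) = (k *: x) * y.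
Proof. by rewrite [RHS]linearZl_LR. Qed.

Lemma tensor_scalerAr (k : K) (x y : A \OT B) : k *: (x * y) = x * (k *: y).
Proof. by rewrite [RHS]linearZr_LR. Qed.

HB.instance Definition _ := GRing.Lmodule_isLalgebra.Build K (A \OT B)
  tensor_scalerAl.
HB.instance Definition _ := GRing.Lalgebra_isAlgebra.Build K (A \OT B)
  tensor_scalerAr.

Lemma tens_mulE (a a' : A) (b b' : B) :
  (a \ot b) * (a' \ot b') = (a * a') \ot (b * b').
Proof. exact: tensor_mul_tens. Qed.

End TensorAlgebra.

Record algModule (K : fieldType) (A : algType K) := AlgModule {
  algmod_sort :> lmodType K;
  act : {bilinear A -> algmod_sort -> algmod_sort};
  act1 : forall v, act 1 v = v;
  actM : forall a b v, act (a * b) v = act a (act b v)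
}.

Section TensorModule.
Variables (K : fieldType) (A B : algType K).
Variables (V : algModule A) (W : algModule B).

Definition tensor_act : {bilinear A \OT B -> V \OT W -> V \OT W} :=
  tbil (act V) (act W).

Lemma tensor_act1 z : tensor_act 1 z = z.
Proof.
elim/tensor_ind: z => [v w|z z' IHz IHz']; last by rewrite linearDr IHz IHz'.
by rewrite [LHS]tbilE !act1.
Qed.

Lemma tensor_actM x y z : tensor_act (x * y) z = tensor_act x (tensor_act y z).
Proof.
elim/tensor_ind: x => [a b|x x' IHx IHx']; last first.
  by rewrite mulrDl !linearDl IHx IHx'.
elim/tensor_ind: y => [a' b'|y y' IHy IHy']; last first.
  by rewrite mulrDr !linearDl linearDr IHy IHy'.
elim/tensor_ind: z => [v w|z z' IHz IHz']; last first.
  by rewrite !linearDr IHz IHz'.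
by rewrite tens_mulE /tensor_act /= !tbilE !actM.
Qed.

(* V (x) W as an (A (x) B)-module *)
Definition tensor_algmod : algModule (A \OT B) :=
  AlgModule tensor_act1 tensor_actM.

End TensorModule.

Definition algmod_aut (K : fieldType) (A : algType K) (M : algModule A)
    (f : M -> M) : Prop :=
  [/\ linear f, bijective f & forall a m, f (act M a m) = act M a (f m)].

Record bialgebra (K : fieldType) := Bialgebra {
  bialg_sort :> algType K;
  comult : {linear bialg_sort -> bialg_sort \OT bialg_sort};
  counit : {linear bialg_sort -> K^o};
  comultA : forall a,
    tassoc bialg_sort bialg_sort bialg_sort (tmap comult idfun (comult a))
    = tmap idfun comult (comult a);
  counitl : forall a, tunitl bialg_sort (tmap counit idfun (comult a)) = a;
  counitr : forall a, tunitr bialg_sort (tmap idfun counit (comult a)) = a;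
  comult1 : comult 1 = 1;
  comultM : {morph comult : a b / a * b}
}.

(* V (x) W as an A-module, through the comultiplication *)
Section ComultModule.
Variables (K : fieldType) (A : bialgebra K) (V W : algModule A).

Definition comult_act_fun (a : A) (z : V \OT W) : V \OT W :=
  act (tensor_algmod V W) (comult A a) z.
Lemma comult_act_is_bilinear : bilinear_for *:%R *:%R comult_act_fun.
Proof.
split=> [z|a] k x y /=; rewrite /comult_act_fun; last by rewrite linearPr.
by rewrite linearP linearPl.
Qed.
HB.instance Definition _ := bilinear_isBilinear.Build K A (V \OT W) (V \OT W)
  *:%R *:%R comult_act_fun comult_act_is_bilinear.
Definition comult_act : {bilinear A -> V \OT W -> V \OT W} := comult_act_fun.

Lemma comult_act1 z : comult_act 1 z = z.
Proof. by rewrite /comult_act /= /comult_act_fun comult1 act1. Qed.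

Lemma comult_actM a b z : comult_act (a * b) z = comult_act a (comult_act b z).
Proof. by rewrite /comult_act /= /comult_act_fun comultM actM. Qed.

Definition comult_algmod : algModule A := AlgModule comult_act1 comult_actM.

End ComultModule.

Section QuasiTriangular.
Variables (K : fieldType) (A : bialgebra K) (r : A \OT A).

Definition almost_cocommutative : Prop :=
  exists r' : A \OT A, [/\ r * r' = 1, r' * r = 1 &
    forall a, flip A A (comult A a) = r * comult A a * r'].

Definition rmx12 : A \OT (A \OT A) := tassoc A A A (r \ot 1).
Definition rmx23 : A \OT (A \OT A) := 1 \ot r.
Definition rmx13 : A \OT (A \OT A) :=
  tassoc A A A (tmap (flip A A) idfun (tassocV A A A rmx23)).

Definition quasi_triangular : Prop :=
  [/\ almost_cocommutative,
      tassoc A A A (tmap (comult A) idfun r) = rmx13 * rmx23 &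
      tmap idfun (comult A) r = rmx13 * rmx12].

Definition tauR (V : algModule A) : {linear V \OT V -> V \OT V} :=
  flip V V \o act (tensor_algmod V V) r.

End QuasiTriangular.

Section TensorPower.
Variables (K : comNzRingType) (V : lmodType K).

(* V^{(x) n.+1}, bracketed to the right: V (x) (V (x) ( ... (x) V)) *)
Fixpoint tpowS (n : nat) : lmodType K :=
  if n is m.+1 then V \OT tpowS m else V.

Definition tpow (n : nat) : lmodType K :=
  if n is m.+1 then tpowS m else K^o.

Variable T : {linear V \OT V -> V \OT V}.

(* T (x) id_W, on V (x) (V (x) W) *)
Definition tleft (W : lmodType K) :
    {linear V \OT (V \OT W) -> V \OT (V \OT W)} :=
  tassoc V V W \o (tmap T idfun \o tassocV V V W).

Definition yang_baxter : Prop :=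
  let T12 := tleft V in let T23 := tmap idfun T in
  T12 \o T23 \o T12 =1 T23 \o T12 \o T23.

(* id^{(x) i} (x) T (x) id^{(x) (n - i - 1)} on V^{(x) n.+1}, for i < n;      *)
(* the other values of i are irrelevant                                       *)
Fixpoint tpowS_at (n i : nat) : {linear tpowS n -> tpowS n} :=
  match n return {linear tpowS n -> tpowS n} with
  | 0 => idfun
  | m.+1 =>
      match i with
      | 0 =>
          match m return {linear V \OT tpowS m -> V \OT tpowS m} with
          | 0 => T
          | m'.+1 => tleft (tpowS m')
          end
      | j.+1 => tmap idfun (tpowS_at m j)
      end
  end.

Definition tpow_at (n i : nat) : {linear tpow n -> tpow n} :=
  match n return {linear tpow n -> tpow n} with
  | 0 => idfun
  | m.+1 => tpowS_at m i
  end.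

End TensorPower.

(* A word is a sequence of letters (i, e), standing for sigma_(i+1) if e is   *)
(* false and for its inverse if e is true.                                    *)

Section BraidGroup.
Variable n : nat.

Definition braid_word := seq ('I_n.-1 * bool).

Inductive braid_rel : braid_word -> braid_word -> Prop :=
| BraidRefl s : braid_rel s s
| BraidSym s t : braid_rel s t -> braid_rel t s
| BraidTrans t s u : braid_rel s t -> braid_rel t u -> braid_rel s u
| BraidCat s s' t t' :
    braid_rel s s' -> braid_rel t t' -> braid_rel (s ++ t) (s' ++ t')
| BraidInv i e : braid_rel [:: (i, e); (i, ~~ e)] [::]
| BraidBraid (i j : 'I_n.-1) : j = i.+1 :> nat ->
    braid_rel [:: (i, false); (j, false); (i, false)]
              [:: (j, false); (i, false); (j, false)]
| BraidComm (i j : 'I_n.-1) : (i.+2 <= j)%N || (j.+2 <= i)%N ->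
    braid_rel [:: (i, false); (j, false)] [:: (j, false); (i, false)].

Definition braid_relb : rel braid_word := fun s t => `[< braid_rel s t >].

Lemma braid_relb_equiv : equiv_class_of braid_relb.
Proof.
split=> [s|s t|t s u].
- by apply/asboolP; constructor.
- by apply/asboolP/asboolP => /BraidSym.
- by move=> /asboolP st /asboolP tu; apply/asboolP; apply: BraidTrans tu.
Qed.

Canonical braid_equiv := EquivRelPack braid_relb_equiv.

Definition braid_group := {eq_quot braid_equiv}.
HB.instance Definition _ := EqQuotient.on braid_group.
HB.instance Definition _ := Choice.on braid_group.

Lemma braid_piP s t :
  braid_rel s t <-> \pi_braid_group s = \pi_braid_group t.
Proof. by split=> [st|/eqmodP/asboolP//]; apply/eqmodP/asboolP. Qed.

Lemma braid_repr s : braid_rel (repr (\pi_braid_group s)) s.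
Proof. by apply/braid_piP; rewrite reprK. Qed.

Definition word_inv (s : braid_word) : braid_word :=
  rev [seq (p.1, ~~ p.2) | p <- s].

Definition braid_one : braid_group := \pi_braid_group [::].
Definition braid_mul (g h : braid_group) : braid_group :=
  \pi_braid_group (repr g ++ repr h).
Definition braid_inv (g : braid_group) : braid_group :=
  \pi_braid_group (word_inv (repr g)).

Lemma pi_braid_mul s t :
  braid_mul (\pi_braid_group s) (\pi_braid_group t) = \pi_braid_group (s ++ t).
Proof. by apply/braid_piP/BraidCat; apply: braid_repr. Qed.

Lemma braid_mulA : associative braid_mul.
Proof.
elim/quotW=> s; elim/quotW=> t; elim/quotW=> u.
by rewrite (pi_braid_mul t u) (pi_braid_mul s t) !pi_braid_mul catA.
Qed.

Lemma braid_mul1g : left_id braid_one braid_mul.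
Proof. by elim/quotW=> s; rewrite pi_braid_mul. Qed.

Lemma braid_mulg1 : right_id braid_one braid_mul.
Proof. by elim/quotW=> s; rewrite pi_braid_mul cats0. Qed.

Lemma word_invK : involutive word_inv.
Proof.
move=> s; rewrite /word_inv map_rev revK -map_comp -[RHS]map_id.
by apply: eq_map => -[i e] /=; rewrite negbK.
Qed.

Lemma braid_rel_mulV s : braid_rel (s ++ word_inv s) [::].
Proof.
elim: s => [|[i e] s IHs]; first exact: BraidRefl.
rewrite /word_inv /= rev_cons -cats1 -/(word_inv s) catA -cat1s.
apply: BraidTrans (BraidInv i e); rewrite -[[:: _; _]]cat1s.
apply: (@BraidCat [:: _] [:: _]); first exact: BraidRefl.
by rewrite -[X in braid_rel _ X]cat0s; apply: BraidCat IHs (BraidRefl _).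
Qed.

Lemma braid_mulgV : right_inverse braid_one braid_inv braid_mul.
Proof.
move=> g; rewrite -[g in braid_mul g _]reprK pi_braid_mul.
exact/braid_piP/braid_rel_mulV.
Qed.

Lemma braid_mulVg : left_inverse braid_one braid_inv braid_mul.
Proof.
move=> g; rewrite -[g in braid_mul _ g]reprK pi_braid_mul.
apply/braid_piP; rewrite -[X in _ ++ X]word_invK.
exact: braid_rel_mulV.
Qed.

HB.instance Definition _ := isGroup.Build braid_group
  braid_mulA braid_mul1g braid_mulg1 braid_mulVg braid_mulgV.

Definition braid_gen (i : 'I_n.-1) : braid_group :=
  \pi_braid_group [:: (i, false)].

End BraidGroup.

Definition linear_rep (K : comNzRingType) (G : groupType) (M : lmodType K)
    (rho : G -> {linear M -> M}) : Prop :=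
  rho 1%g =1 id /\ forall g h, rho (g * h)%g =1 rho g \o rho h.

(* Main.v *)
(* Since r Delta(a) = Delta^op(a) r, the hexagon (Delta (x) id) r = r13 r23
   gives r12 r13 r23 = (Delta^op (x) id)(r) r12 = r23 r13 r12.  Write
   T = tau r for the braiding of V (x) V, and s12, s23 for the swaps of adjacent
   factors of V (x) V (x) V.  Moving the swaps to the left turns T12 T23 T12 into
   s12 s23 s12 r23 r13 r12 and T23 T12 T23 into s23 s12 s23 r12 r13 r23, and
   these agree.  The operators T_i on tensor powers then satisfy the relations
   of the braid group, and evaluating words gives the representation. *)
Require Import Defs.
From mathcomp Require Import all_boot all_order all_algebra.
From mathcomp Require Import reals complex.

Set Implicit Arguments.
Unset Strict Implicit.
Unset Printing Implicit Defensive.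

Local Open Scope ring_scope.

Import GRing.Theory.

(** * Pure-tensor induction and swaps of adjacent factors *)

Section TensorMisc.
Variable K : comNzRingType.

Lemma tensor3_ind (U V W : lmodType K) (P : U \OT (V \OT W) -> Prop) :
  (forall u v w, P (u \ot (v \ot w))) ->
  (forall x y, P x -> P y -> P (x + y)) -> forall x, P x.
Proof.
move=> Pt PD; apply: tensor_ind => // u.
by elim/tensor_ind=> [v w|x y Px Py]; rewrite ?linearDr; [apply: Pt|apply: PD].
Qed.

Lemma tensor3_ext (U V W X : lmodType K) (g h : {linear U \OT (V \OT W) -> X}) :
  (forall u v w, g (u \ot (v \ot w)) = h (u \ot (v \ot w))) -> g =1 h.
Proof.
move=> gh; elim/tensor3_ind=> [u v w|x y IHx IHy]; first exact: gh.
by rewrite !linearD IHx IHy.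
Qed.

Lemma flipK (V W : lmodType K) : cancel (flip V W) (flip W V).
Proof.
elim/tensor_ind=> [v w|x y IHx IHy]; first by rewrite !flipE.
by rewrite !linearD IHx IHy.
Qed.

Lemma tassocK (U V W : lmodType K) : cancel (tassoc U V W) (tassocV U V W).
Proof.
elim/tensor_ind=> [x w|x y IHx IHy]; last by rewrite !linearD IHx IHy.
elim/tensor_ind: x => [u v|x y IHx IHy]; first by rewrite tassocE tassocVE.
by rewrite linearDl !linearD IHx IHy.
Qed.

Lemma tmap_idE (V W X : lmodType K) (f : {linear W -> X}) (v : V) w :
  tmap idfun f (v \ot w) = v \ot f w.
Proof. exact: tmapE. Qed.

Lemma tmap_id_ext (V W X : lmodType K) (f g : {linear W -> X}) :
  f =1 g -> tmap (V := V) idfun f =1 tmap idfun g.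
Proof. by move=> fg; apply: tensor_ext => v w; rewrite !tmapE fg. Qed.

Lemma tmap_id_comp (V W X Y : lmodType K)
    (f : {linear X -> Y}) (g : {linear W -> X}) :
  tmap (V := V) idfun (f \o g) =1 tmap idfun f \o tmap idfun g.
Proof. by apply: tensor_ext => v w; rewrite /= !tmapE. Qed.

(** The same composite as in [rmx13], so [rmx13 r] is [swap12 A A A (rmx23 r)] by conversion. *)
Definition swap12 (V W X : lmodType K) :
    {linear V \OT (W \OT X) -> W \OT (V \OT X)} :=
  tassoc W V X \o (tmap (flip V W) idfun \o tassocV V W X).

Definition swap23 (V W X : lmodType K) :
    {linear V \OT (W \OT X) -> V \OT (X \OT W)} := tmap idfun (flip W X).

Lemma swap12E (V W X : lmodType K) (v : V) (w : W) (x : X) :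
  swap12 V W X (v \ot (w \ot x)) = w \ot (v \ot x).
Proof. by rewrite /= tassocVE tmapE flipE tassocE. Qed.

Lemma swap23E (V W X : lmodType K) (v : V) (w : W) (x : X) :
  swap23 V W X (v \ot (w \ot x)) = v \ot (x \ot w).
Proof. by rewrite /= tmapE flipE. Qed.

Lemma swap12K (V W X : lmodType K) : cancel (swap12 V W X) (swap12 W V X).
Proof.
elim/tensor3_ind=> [u v w|x y IHx IHy]; first by rewrite !swap12E.
by rewrite !linearD IHx IHy.
Qed.

Lemma swap23K (V W X : lmodType K) : cancel (swap23 V W X) (swap23 V X W).
Proof.
elim/tensor3_ind=> [u v w|x y IHx IHy]; first by rewrite !swap23E.
by rewrite !linearD IHx IHy.
Qed.

(** Both sides reverse the order of the three factors. *)
Lemma swap_braid (V W X : lmodType K) x :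
  swap12 W X V (swap23 W V X (swap12 V W X x)) =
  swap23 X V W (swap12 V X W (swap23 V W X x)).
Proof.
elim/tensor3_ind: x => [u v w|x y IHx IHy]; last by rewrite !linearD IHx IHy.
by rewrite !(swap12E, swap23E).
Qed.

Lemma swap12_tassoc (V W X : lmodType K) (y : V \OT W) (x : X) :
  swap12 V W X (tassoc V W X (y \ot x)) = tassoc W V X (flip V W y \ot x).
Proof. by rewrite [LHS]/= tassocK tmapE. Qed.

End TensorMisc.

(** * Compatibility of swaps and reassociation with actions and products *)

Section TensorAction.
Variables (K : fieldType) (A B : algType K).
Variables (V : algModule A) (W : algModule B).

Lemma act_tens (a : A) (b : B) (v : V) (w : W) :
  act (tensor_algmod V W) (a \ot b) (v \ot w) = act V a v \ot act W b w.
Proof. exact: tbilE. Qed.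

Lemma flip_act (x : A \OT B) (z : V \OT W) :
  flip V W (act (tensor_algmod V W) x z) =
  act (tensor_algmod W V) (flip A B x) (flip V W z).
Proof.
elim/tensor_ind: x => [a b|x y IHx IHy]; last first.
  by rewrite !(linearDl, linearD) IHx IHy.
elim/tensor_ind: z => [v w|z z' IHz IHz']; last first.
  by rewrite !(linearDr, linearD) IHz IHz'.
by rewrite act_tens !flipE [RHS]tbilE.
Qed.

End TensorAction.

Section TensorAction3.
Variables (K : fieldType) (A B C : algType K).
Variables (V : algModule A) (W : algModule B) (X : algModule C).

Local Notation VWX := (tensor_algmod V (tensor_algmod W X)).

(** Lets a swap be moved past an element of the threefold tensor algebra, whose factors it permutes.
    Both sides are additive in [x] and [z], so pure tensors suffice. *)
Lemma swap12_act (x : A \OT (B \OT C)) (z : V \OT (W \OT X)) :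
  swap12 V W X (act VWX x z) =
  act (tensor_algmod W (tensor_algmod V X)) (swap12 A B C x) (swap12 V W X z).
Proof.
elim/tensor3_ind: x => [a b c|x y IHx IHy]; last first.
  by rewrite !(linearDl, linearD) IHx IHy.
elim/tensor3_ind: z => [u v w|z z' IHz IHz']; last first.
  by rewrite !(linearDr, linearD) IHz IHz'.
by rewrite swap12E swap12E !act_tens swap12E.
Qed.

Lemma swap23_act (x : A \OT (B \OT C)) (z : V \OT (W \OT X)) :
  swap23 V W X (act VWX x z) =
  act (tensor_algmod V (tensor_algmod X W)) (swap23 A B C x) (swap23 V W X z).
Proof.
elim/tensor3_ind: x => [a b c|x y IHx IHy]; last first.
  by rewrite !(linearDl, linearD) IHx IHy.
elim/tensor3_ind: z => [u v w|z z' IHz IHz']; last first.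
  by rewrite !(linearDr, linearD) IHz IHz'.
by rewrite swap23E swap23E !act_tens swap23E.
Qed.

Lemma tassoc_act (x : A \OT B) (c : C) (z : V \OT W) (w : X) :
  tassoc V W X (act (tensor_algmod V W) x z \ot act X c w) =
  act VWX (tassoc A B C (x \ot c)) (tassoc V W X (z \ot w)).
Proof.
elim/tensor_ind: x => [a b|x y IHx IHy]; last first.
  by rewrite !(linearDl, linearD) IHx IHy.
elim/tensor_ind: z => [u v|z z' IHz IHz']; last first.
  by rewrite !(linearDr, linearDl, linearD) IHz IHz'.
by rewrite !(act_tens, tassocE).
Qed.

Lemma swap12M (x y : A \OT (B \OT C)) :
  swap12 A B C (x * y) = swap12 A B C x * swap12 A B C y.
Proof.
elim/tensor3_ind: x => [a b c|x x' IHx IHx']; last first.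
  by rewrite mulrDl !linearD IHx IHx' mulrDl.
elim/tensor3_ind: y => [a' b' c'|y y' IHy IHy']; last first.
  by rewrite mulrDr !linearD IHy IHy' mulrDr.
by rewrite !(tens_mulE, swap12E).
Qed.

Lemma tassocM (x y : A \OT B) (c c' : C) :
  tassoc A B C (x \ot c) * tassoc A B C (y \ot c') =
  tassoc A B C ((x * y) \ot (c * c')).
Proof.
elim/tensor_ind: x => [a b|x x' IHx IHx']; last first.
  by rewrite !(linearDl, linearD) !mulrDl IHx IHx' !(linearDl, linearD).
elim/tensor_ind: y => [a' b'|y y' IHy IHy']; last first.
  by rewrite !(linearDl, linearD) !mulrDr IHy IHy' !(linearDl, linearD).
by rewrite !(tens_mulE, tassocE).
Qed.

End TensorAction3.

(** * The Yang-Baxter equation for the universal r-matrix and for its action *)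

Section UniversalRMatrix.
Variables (K : fieldType) (A : bialgebra K) (r : A \OT A).

Lemma swap12_rmx13 : swap12 A A A (rmx13 r) = rmx23 r.
Proof. exact: swap12K. Qed.

Lemma swap23_rmx12 : swap23 A A A (rmx12 r) = rmx13 r.
Proof.
rewrite -[RHS]/(swap12 A A A (1 \ot r)) /rmx12.
elim/tensor_ind: r => [a b|x y IHx IHy]; last first.
  by rewrite !(linearDl, linearDr, linearD) IHx IHy.
by rewrite tassocE swap23E swap12E.
Qed.

Lemma swap23_rmx13 : swap23 A A A (rmx13 r) = rmx12 r.
Proof. by rewrite -swap23_rmx12 swap23K. Qed.

Hypothesis qtA : quasi_triangular r.

Lemma flip_comultM a : flip A A (comult A a) * r = r * comult A a.
Proof.
by case: qtA => -[r' [_ r'r ->]] _ _; rewrite -mulrA r'r mulr1.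
Qed.

(** For [x = a \ot b] the first two factors intertwine by [flip_comultM], while the third is [b]
    multiplied by 1 on either side. The general case follows by additivity. *)
Lemma rmx12_comult (x : A \OT A) :
  rmx12 r * tassoc A A A (tmap (comult A) idfun x) =
  swap12 A A A (tassoc A A A (tmap (comult A) idfun x)) * rmx12 r.
Proof.
elim/tensor_ind: x => [a b|x y IHx IHy]; last first.
  by rewrite !(linearDl, linearD) mulrDl mulrDr IHx IHy.
by rewrite tmapE swap12_tassoc !tassocM flip_comultM mul1r mulr1.
Qed.

Lemma rmx_yang_baxter :
  rmx12 r * (rmx13 r * rmx23 r) = rmx23 r * (rmx13 r * rmx12 r).
Proof.
(* The hexagon is read backwards to expose the comultiplication, then forwards under [swap12], which
   exchanges r13 and r23. *)
case: qtA => _ qt _; rewrite -[in LHS]qt rmx12_comult qt swap12M swap12_rmx13.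
by rewrite -[swap12 _ _ _ (rmx23 r)]/(rmx13 r) mulrA.
Qed.

Variable V : algModule A.

Local Notation V3 := (tensor_algmod V (tensor_algmod V V)).

Lemma tauRE z : tauR r V z = flip V V (act (tensor_algmod V V) r z).
Proof. by []. Qed.

Definition tauR_inv (r' : A \OT A) : {linear V \OT V -> V \OT V} :=
  act (tensor_algmod V V) r' \o flip V V.

Lemma tauR_invE r' z :
  tauR_inv r' z = act (tensor_algmod V V) r' (flip V V z).
Proof. by []. Qed.

Lemma tauRK r' : r' * r = 1 -> cancel (tauR r V) (tauR_inv r').
Proof. by move=> r'r z; rewrite tauR_invE tauRE flipK -actM r'r act1. Qed.

Lemma tauR_invK r' : r * r' = 1 -> cancel (tauR_inv r') (tauR r V).
Proof. by move=> rr' z; rewrite tauR_invE tauRE -actM rr' act1 flipK. Qed.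

Lemma tauR_aut : algmod_aut (M := comult_algmod V V) (tauR r V).
Proof.
case: (qtA) => -[r' [rr' r'r _]] _ _; split.
- exact: linearP.
- by exists (tauR_inv r'); [apply: tauRK | apply: tauR_invK].
- move=> a z; change (tauR r V (act (tensor_algmod V V) (comult A a) z) =
    act (tensor_algmod V V) (comult A a) (tauR r V z)).
  (* tau r Delta(a) = tau Delta^op(a) r = Delta(a) tau r. *)
  by rewrite !tauRE -actM -flip_comultM actM flip_act flipK.
Qed.

(** Separates the swap from the action of r12, so that all swaps can later be collected on the
    left. *)
Lemma tleft_tauR z :
  tleft (tauR r V) V z = swap12 V V V (act V3 (rmx12 r) z).
Proof.
elim/tensor3_ind: z => [u v w|x y IHx IHy]; last first.
  by rewrite !(linearDr, linearD) IHx IHy.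
rewrite -[in RHS]tassocE -tassoc_act act1 swap12_tassoc.
by rewrite /= tassocVE tmapE.
Qed.

Lemma tmap_id_tauR z :
  tmap idfun (tauR r V) z = swap23 V V V (act V3 (rmx23 r) z).
Proof.
elim/tensor_ind: z => [u z|x y IHx IHy]; last first.
  by rewrite !(linearDr, linearD) IHx IHy.
by rewrite act_tens act1 /= !tmapE.
Qed.

Lemma tauR_yang_baxter : yang_baxter (tauR r V).
Proof.
pose s12 := swap12 V V V; pose s23 := swap23 V V V.
have act_s12 x z : act V3 x (s12 z) = s12 (act V3 (swap12 A A A x) z).
  by rewrite swap12_act swap12K.
have act_s23 x z : act V3 x (s23 z) = s23 (act V3 (swap23 A A A x) z).
  by rewrite swap23_act swap23K.
move=> z; rewrite /comp !tleft_tauR !tmap_id_tauR.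
(* On the left side, r23 passes one s12 and becomes r13; the outer r12 passes s23, then s12, and
   becomes r13, then r23. *)
rewrite -/s12 -/s23 act_s12 -/(rmx13 r) act_s23 act_s12.
rewrite swap23_rmx12 swap12_rmx13.
(* On the right side, r12 passes s23 and becomes r13; the outer r23 passes s12, then s23, and
   becomes r13, then r12. *)
rewrite [in RHS]act_s23 act_s12 act_s23 swap23_rmx12 swap23_rmx13.
rewrite -!actM -[X in _ = X]swap_braid.
by rewrite -!mulrA rmx_yang_baxter.
Qed.

End UniversalRMatrix.

(** * Braid group representations from invertible operators satisfying the relations *)

Section BraidOperators.
Variables (K : comNzRingType) (M : lmodType K) (n : nat).
Variables S S' : 'I_n.-1 -> {linear M -> M}.

Definition letter_op (p : 'I_n.-1 * bool) : {linear M -> M} :=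
  if p.2 then S' p.1 else S p.1.

Fixpoint word_op (s : braid_word n) : {linear M -> M} :=
  if s is p :: s' then letter_op p \o word_op s' else idfun.

Lemma word_op_cat s t : word_op (s ++ t) =1 word_op s \o word_op t.
Proof. by move=> x; elim: s => //= p s ->. Qed.

Hypothesis SK : forall i, cancel (S i) (S' i).
Hypothesis SVK : forall i, cancel (S' i) (S i).
Hypothesis S_braid : forall i j : 'I_n.-1, j = i.+1 :> nat ->
  S i \o S j \o S i =1 S j \o S i \o S j.
Hypothesis S_comm : forall i j : 'I_n.-1, (i.+2 <= j)%N ->
  S i \o S j =1 S j \o S i.

(** Induction on the derivation of the relation: each generating relation is one of the hypotheses
    on [S] and [S'], and the closure rules are respected by composition. *)
Lemma word_op_rel s t : braid_rel s t -> word_op s =1 word_op t.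
Proof.
elim=> {s t} [s|s t _ IH|t s u _ IHst _ IHtu|s s' t t' _ IHs _ IHt|i e|i j ij
             |i j /orP[]ij] x //=.
- by rewrite IHst.
- by rewrite !word_op_cat /= IHt IHs.
- by case: e; rewrite /letter_op /= ?SK ?SVK.
- exact: S_braid.
- exact: S_comm.
(* [S_comm] covers only the order i < j; the other order is its mirror image. *)
- by rewrite [RHS]S_comm.
Qed.

(** A class acts through its chosen representative. By [word_op_rel] any other word of the class
    gives the same operator, in particular the concatenation for a product and the one-letter word
    for a generator. *)
Lemma braid_rep_exists : exists2 rho : braid_group n -> {linear M -> M},
  linear_rep rho & forall i, rho (braid_gen i) =1 S i.
Proof.
exists (fun g => word_op (repr g)) => [|i x]; last first.
  exact: (word_op_rel (braid_repr _)).
split=> [x|g h x]; first exact: (word_op_rel (braid_repr [::])).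
by rewrite -word_op_cat; apply: (word_op_rel (braid_repr _)).
Qed.

End BraidOperators.

(** * Braid relations on tensor powers *)

Section TensorPowerBraid.
Variables (K : comNzRingType) (V : lmodType K).

Lemma tmap_idK (W : lmodType K) (f g : {linear W -> W}) :
  cancel f g -> cancel (tmap (V := V) idfun f) (tmap idfun g).
Proof.
move=> fK; elim/tensor_ind=> [v w|x y IHx IHy]; first by rewrite !tmapE fK.
by rewrite !linearD IHx IHy.
Qed.

Lemma tleftE (T : {linear V \OT V -> V \OT V}) (W : lmodType K) v v' (w : W) :
  tleft T W (v \ot (v' \ot w)) = tassoc V V W (T (v \ot v') \ot w).
Proof. by rewrite /= tassocVE tmapE. Qed.

(** Extends [tleftE] to an arbitrary [x], as needed for iterating: [T] need not send pure tensors to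
    pure tensors. *)
Lemma tleft_tassoc (T : {linear V \OT V -> V \OT V}) (W : lmodType K) x (w : W) :
  tleft T W (tassoc V V W (x \ot w)) = tassoc V V W (T x \ot w).
Proof. by rewrite [LHS]/= tassocK tmapE. Qed.

Lemma tleftK (T T' : {linear V \OT V -> V \OT V}) (W : lmodType K) :
  cancel T T' -> cancel (tleft T W) (tleft T' W).
Proof.
move=> TK; elim/tensor3_ind=> [v v' w|x y IHx IHy].
  by rewrite tleftE tleft_tassoc TK tassocE.
by rewrite !linearD IHx IHy.
Qed.

Lemma tleft_tmap_comm (T : {linear V \OT V -> V \OT V}) (W : lmodType K)
    (f : {linear W -> W}) :
  tleft T W \o tmap idfun (tmap idfun f) =1
  tmap idfun (tmap idfun f) \o tleft T W.
Proof.
apply: tensor3_ext => u v w; change (tleft T W (tmap idfun (tmap idfun f) (u \ot (v \ot w))) =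
  tmap idfun (tmap idfun f) (tleft T W (u \ot (v \ot w)))).
rewrite !tmapE !tleftE.
elim/tensor_ind: (T _) => [a b|x y IHx IHy]; last first.
  by rewrite !(linearDl, linearD) IHx IHy.
by rewrite !tassocE !tmapE.
Qed.

Lemma tpowS_atK (T T' : {linear V \OT V -> V \OT V}) m i :
  cancel T T' -> cancel (tpowS_at T m i) (tpowS_at T' m i).
Proof.
move=> TK; elim: m i => [|m IHm] [|i] //=; last exact: tmap_idK.
by case: m {IHm} => [|m] //; apply: tleftK.
Qed.

Variable T : {linear V \OT V -> V \OT V}.

Lemma tpowS_at_comm m i j : (i.+2 <= j)%N -> (j < m)%N ->
  tpowS_at T m i \o tpowS_at T m j =1 tpowS_at T m j \o tpowS_at T m i.
Proof.
elim: m i j => [|m IHm] [|i] [|j] // ij jm x; last first.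
  have /tmap_id_ext/(_ x) := IHm i j ij jm.
  by rewrite !tmap_id_comp.
(* Once the common leading factors are stripped, the smaller index is 0 and the larger at least 2,
   so the second operator fixes the two factors on which [T] acts. *)
case: m j ij jm x {IHm} => [|m] [|j] // _ _ x.
exact: tleft_tmap_comm.
Qed.

Hypothesis ybT : yang_baxter T.

(* A fourth factor W is carried along through the isomorphism
   (V (x) (V (x) V)) (x) W = V (x) (V (x) (V (x) W)). *)
Lemma yang_baxter_tleft (W : lmodType K) :
  let T12 := tleft T (V \OT W) in let T23 := tmap idfun (tleft T W) in
  T12 \o T23 \o T12 =1 T23 \o T12 \o T23.
Proof.
pose phi : {linear (V \OT (V \OT V)) \OT W -> V \OT (V \OT (V \OT W))} :=
  tmap idfun (tassoc V V W) \o tassoc V (V \OT V) W.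
have phiE a b c w : phi ((a \ot (b \ot c)) \ot w) = a \ot (b \ot (c \ot w)).
  by rewrite /phi /= tassocE tmapE /= tassocE.
(* [phi] transports the operators on three factors, tensored with the identity of [W], to those on
   four. The inner induction splits the value of [T] into pure tensors. *)
have phi12 x w : tleft T (V \OT W) (phi (x \ot w)) = phi (tleft T V x \ot w).
  elim/tensor3_ind: x => [a b c|x y IHx IHy]; last first.
    by rewrite !(linearDl, linearD) IHx IHy.
  rewrite phiE !tleftE; elim/tensor_ind: (T _) => [a' b'|x y IHx IHy].
    by rewrite !tassocE phiE.
  by rewrite !(linearDl, linearD) IHx IHy.
have phi23 x w : tmap idfun (tleft T W) (phi (x \ot w)) =
    phi (tmap idfun T x \ot w).
  elim/tensor3_ind: x => [a b c|x y IHx IHy]; last first.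
    by rewrite !(linearDl, linearD) IHx IHy.
  rewrite phiE !tmap_idE tleftE.
  elim/tensor_ind: (T _) => [b' c'|x y IHx IHy].
    by rewrite tassocE phiE.
  by rewrite !(linearDl, linearDr, linearD); congr (_ + _).
move=> T12 T23 z; elim/tensor3_ind: z => [a b z|x y IHx IHy]; last first.
  by rewrite /comp in IHx IHy *; rewrite !linearD IHx IHy.
elim/tensor_ind: z => [c w|x y IHx IHy]; last first.
  by rewrite /comp in IHx IHy *; rewrite !linearDr !linearD IHx IHy.
rewrite /comp -phiE !(phi12, phi23); congr (phi (_ \ot _)); exact: ybT.
Qed.

Lemma tpowS_at_braid m i : (i.+1 < m)%N ->
  tpowS_at T m i \o tpowS_at T m i.+1 \o tpowS_at T m i =1
  tpowS_at T m i.+1 \o tpowS_at T m i \o tpowS_at T m i.+1.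
Proof.
elim: m i => [|m IHm] [|i] // im x; last first.
  have /tmap_id_ext/(_ x) := IHm i im.
  by rewrite !tmap_id_comp /comp !tmap_id_comp.
(* With exactly three factors this is [ybT] itself; beyond that, [W] is the tensor product of all
   factors after the third. *)
case: m x im {IHm} => [|[|m]] // x _; first exact: ybT.
exact: yang_baxter_tleft.
Qed.

End TensorPowerBraid.

Theorem corollary5p10 (R : realType) (A : bialgebra R[i]) (r : A \OT A)
    (V : algModule A) (qtA : quasi_triangular r) :
  [/\ algmod_aut (M := comult_algmod V V) (tauR r V),
      yang_baxter (tauR r V) &
      forall n : nat, (2 <= n)%N ->
        exists2 rho : braid_group n -> {linear tpow V n -> tpow V n},
          linear_rep rho &
          forall i : 'I_n.-1, rho (braid_gen i) =1 tpow_at (tauR r V) n i].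
Proof.
have yb := tauR_yang_baxter qtA (V := V).
(* With n = m + 1, [tpow V n] reduces to [tpowS V m] and the generators are indexed by ['I_m]. *)
split=> [||[|m] // _]; [exact: tauR_aut | exact: yb |].
have [r' [rr' r'r _]] : almost_cocommutative r by case: qtA.
apply: (@braid_rep_exists _ _ m.+1 (fun i => tpow_at (tauR r V) m.+1 i)
  (fun i => tpow_at (tauR_inv V r') m.+1 i)) => [i|i|i j ij|i j ij].
- exact/tpowS_atK/tauRK.
- exact/tpowS_atK/tauR_invK.
(* The required bound i + 1 < m is the ordinal bound on [j]. *)
- by rewrite ij; apply: tpowS_at_braid => //; rewrite -ij.
- exact: tpowS_at_comm.
Qed.
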